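(* Let $D\ge1$, $p>0$, integers $b\ge1$, $k\ge1$, $B\ge1$, and nonzero $u,v\in\mathbb{R}^D$. For $j=1,\dots,k$, let $(i^*_{u,j},t^*_{u,j})$, $(i^*_{v,j},t^*_{v,j})$ be GCWS outputs for $u$ and $v$ computed with the $j$-th set of shared random numbers, the $k$ sets being mutually independent, and let $(i^*_{u,j},t^*_{u,j})_b=g_j(i^*_{u,j},t^*_{u,j})$, $(i^*_{v,j},t^*_{v,j})_b=g_j(i^*_{v,j},t^*_{v,j})$, where $g_1,\dots,g_k$ are mutually independent random functions from $\{1,\dots,2D\}\times\mathbb{Z}$ to $\{0,\dots,2^b-1\}$ with independent uniform values, independent of all GCWS randomness. Let $P_b=P\{(i^*_{u,1},t^*_{u,1})_b=(i^*_{v,1},t^*_{v,1})_b\}$. Let $x,y\in\{0,1\}^{d}$, $d=2^b k$, be the concatenations of the one-hot encodings of $(i^*_{u,j},t^*_{u,j})_b$, $j=1..k$, and of $(i^*_{v,j},t^*_{v,j})_b$, $j=1..k$, respectively. Let $z,w\in\mathbb{R}^B$ be the count-sketch of $x$ and $y$ with $B$ bins (described in the context), the count-sketch randomness being independent of everything else. Let $$a=\sum_{j=1}^k 1\{(i^*_{u,j},t^*_{u,j})_b=(i^*_{v,j},t^*_{v,j})_b\}.$$ Then, conditioning on all the values $(i^*_{u,j},t^*_{u,j})_b,(i^*_{v,j},t^*_{v,j})_b$, $j=1,\dots,k$ (denoted GCWS), $$E\{\langle z,w\rangle\mid \text{GCWS}\}=a,\qquad \mathrm{Var}\{\langle z,w\rangle\mid\text{GCWS}\}=\frac1B\left[k^2+a^2-2a\right];$$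 $a$ has the binomial distribution $\mathrm{Bin}(k,P_b)$; unconditionally $$E\{\langle z,w\rangle\}=kP_b,\qquad \mathrm{Var}\{\langle z,w\rangle\}=\frac1B\left[k^2+k^2P_b^2-kP_b^2-kP_b\right]+kP_b(1-P_b);$$ and the estimator $\hat P_b=\langle z,w\rangle/k$ satisfies $$E(\hat P_b)=P_b,\qquad \mathrm{Var}(\hat P_b)=\frac{P_b(1-P_b)}{k}+\frac1B\left[1+P_b^2-P_b^2/k-P_b/k\right].$$
   Context: Sign-splitting transformation: for $u\in\mathbb{R}^D$, $\tilde u\in\mathbb{R}^{2D}$ with, for each $i$: if $u_i>0$ then $\tilde u_{2i-1}=u_i,\tilde u_{2i}=0$; if $u_i\le 0$ then $\tilde u_{2i-1}=0,\tilde u_{2i}=-u_i$. GCWS procedure (one set of random numbers): draw independently for $i=1,\dots,2D$: $r_i\sim\mathrm{Gamma}(2,1)$, $c_i\sim\mathrm{Gamma}(2,1)$, $\beta_i\sim\mathrm{Uniform}(0,1)$; for each $i$ with $\tilde u_i>0$ set $t_i=\lfloor p\log(\tilde u_i)/r_i+\beta_i\rfloor$, $a_i=\log(c_i)-r_i(t_i+1-\beta_i)$ (zero entries skipped); output $i^*=\arg\min_i a_i$, $t^*=t_{i^*}$. The same random numbers are used for $v$. One-hot concatenation: the value $h_j\in\{0,\dots,2^b-1\}$ is encoded as the vector in $\{0,1\}^{2^b}$ with a single 1 in position $h_j$; concatenating the $k$ encodings gives a vector of length $2^b k$ with exactly $k$ ones. Count-sketch with $B$ bins of $x\in\mathbb{R}^d$: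 draw $h(1),\dots,h(d)$ i.i.d. uniform on $\{1,\dots,B\}$ and, independently, $s_1,\dots,s_d$ i.i.d. uniform on $\{-1,+1\}$; set $z_m=\sum_{i=1}^d x_i s_i 1\{h(i)=m\}$ for $m=1,\dots,B$. The sketch $w$ of $y$ uses the same $h$ and $s$. $\langle z,w\rangle=\sum_{m=1}^B z_m w_m$. *)

(* Defs.v *)
From HB Require Import structures.
From mathcomp Require Import all_boot all_order all_algebra.
From mathcomp Require Import all_classical all_reals all_analysis.
Set Implicit Arguments. Unset Strict Implicit. Unset Printing Implicit Defensive.
Import Order.TTheory GRing.Theory Num.Theory.
Import numFieldNormedType.Exports.
Local Open Scope classical_set_scope.
Local Open Scope ring_scope.

Section Defs.
Context {R : realType}.

(** Sign splitting (0-based indices): component q of u (q < D) goes to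
    positions 2q (positive part) and 2q+1 (negated non-positive part); these
    are the paper's positions 2i-1 and 2i for i = q+1. *)
Definition sign_split (D : nat) (u : 'I_D -> R) (i : 'I_(2 * D)) : R :=
  let q := odflt 0 (omap u (insub (i %/ 2)%N : option 'I_D)) in
  if ~~ odd i then (if 0 < q then q else 0) else (if q <= 0 then - q else 0).

Definition gcws_t (D : nat) (p : R) (ut r beta : 'I_(2 * D) -> R) (i : 'I_(2 * D))
  : int := Num.floor (p * ln (ut i) / r i + beta i).

Definition gcws_a (D : nat) (p : R) (ut r c beta : 'I_(2 * D) -> R)
  (i : 'I_(2 * D)) : R :=
  ln (c i) - r i * ((gcws_t p ut r beta i)%:~R + 1 - beta i).

(** Output (i-star, t-star): an index minimizing a_i among the i with ut_i > 0
    (ties, a probability-zero event, are broken by [pick]); None iff ut = 0. *)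
Definition gcws (D : nat) (p : R) (u : 'I_D -> R) (r c beta : 'I_(2 * D) -> R)
  : option ('I_(2 * D) * int) :=
  let ut := sign_split u in
  omap (fun i => (i, gcws_t p ut r beta i))
    [pick i | (0 < ut i) &&
      [forall i', (0 < ut i') ==> (gcws_a p ut r c beta i <= gcws_a p ut r c beta i')]].

Definition onehot_cat (b k : nat) (hv : 'I_k -> option 'I_(2 ^ b))
  (m : 'I_(2 ^ b * k)) : R :=
  match (insub (m %/ 2 ^ b)%N : option 'I_k) with
  | Some j => if hv j is Some hj then ((val hj == m %% 2 ^ b)%N)%:R else 0
  | None => 0
  end.

Definition count_sketch (n B : nat) (h : 'I_n -> 'I_B) (s : 'I_n -> bool)
  (x : 'I_n -> R) : 'I_B -> R :=
  fun m => \sum_(i < n) x i * (-1) ^+ s i * (h i == m)%:R.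

Definition dotB (B : nat) (z w : 'I_B -> R) : R := \sum_(m < B) z m * w m.

Section Prob.
Context {d : measure_display} {T : measurableType d} (P : probability T R).

Definition mutually_independent (I : eqType) (X : I -> T -> R) : Prop :=
  (forall i, measurable_fun setT (X i)) /\
  forall (s : seq I) (A : I -> set R), uniq s -> (forall i, measurable (A i)) ->
    P (\bigcap_(i in [set` s]) (X i @^-1` A i)) = (\prod_(i <- s) P (X i @^-1` A i))%E.

Definition gamma21_law (X : T -> R) : Prop :=
  forall A : set R, measurable A ->
    P (X @^-1` A) = (\int[lebesgue_measure]_(x in A `&` `]0%R, +oo[%classic)
                        (x * expR (- x))%:E)%E.

Definition uniform01_law (X : T -> R) : Prop :=
  forall A : set R, measurable A ->
    P (X @^-1` A) = lebesgue_measure (A `&` `]0%R, 1%R[%classic).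

Definition uniform_fin_law (V : finType) (X : T -> V) : Prop :=
  (forall v : V, measurable [set w | X w = v]) /\
  forall v : V, P [set w | X w = v] = (#|V|%:R^-1)%:E.

(** Elementary conditional expectation / variance given an event A
    (used for P A > 0; conditioning on a finitely-valued random variable). *)
Definition cond_exp (X : T -> R) (A : set T) : R :=
  fine ('E_P[X \* \1_A]) / fine (P A).

Definition cond_var (X : T -> R) (A : set T) : R :=
  cond_exp (fun w => (X w - cond_exp X A) ^+ 2) A.
End Prob.

(** Index type of all primitive random variables:
    inl ((j,i),0|1|2)  : r_{j,i}, c_{j,i}, beta_{j,i}
    inr (inl (j,i,t))  : g_j(i,t)
    inr (inr (m,false)): h(m) ;  inr (inr (m,true)) : s_m *)
Definition prim_index (D b k : nat) : eqType :=
  (('I_k * 'I_(2 * D)) * 'I_3 + (('I_k * 'I_(2 * D) * int) + ('I_(2 ^ b * k) * bool)))%type.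

Definition prim_family {T : Type} (D b k B : nat)
  (r c beta : 'I_k -> 'I_(2 * D) -> T -> R)
  (g : 'I_k -> 'I_(2 * D) -> int -> T -> 'I_(2 ^ b))
  (h : 'I_(2 ^ b * k) -> T -> 'I_B) (s : 'I_(2 ^ b * k) -> T -> bool)
  (x : prim_index D b k) : T -> R :=
  match x with
  | inl (ji, l) => if val l == 0%N then r ji.1 ji.2
                   else if val l == 1%N then c ji.1 ji.2 else beta ji.1 ji.2
  | inr (inl (jit)) => fun w => (val (g jit.1.1 jit.1.2 jit.2 w))%:R
  | inr (inr (m, false)) => fun w => (val (h m w))%:R
  | inr (inr (m, true)) => fun w => (s m w)%:R
  end.

Definition hashed_gcws {T : Type} (D b k : nat) (p : R) (u : 'I_D -> R)
  (r c beta : 'I_k -> 'I_(2 * D) -> T -> R)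
  (g : 'I_k -> 'I_(2 * D) -> int -> T -> 'I_(2 ^ b)) (j : 'I_k) (w : T)
  : option 'I_(2 ^ b) :=
  omap (fun it => g j it.1 it.2 w) (gcws p u (r j ^~ w) (c j ^~ w) (beta j ^~ w)).

Definition sketch_inner {T : Type} (D b k B : nat) (p : R) (u v : 'I_D -> R)
  (r c beta : 'I_k -> 'I_(2 * D) -> T -> R)
  (g : 'I_k -> 'I_(2 * D) -> int -> T -> 'I_(2 ^ b))
  (h : 'I_(2 ^ b * k) -> T -> 'I_B) (s : 'I_(2 ^ b * k) -> T -> bool) (w : T) : R :=
  dotB (count_sketch (h ^~ w) (s ^~ w) (onehot_cat (fun j => hashed_gcws p u r c beta g j w)))
       (count_sketch (h ^~ w) (s ^~ w) (onehot_cat (fun j => hashed_gcws p v r c beta g j w))).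

Definition n_matches {T : Type} (D b k : nat) (p : R) (u v : 'I_D -> R)
  (r c beta : 'I_k -> 'I_(2 * D) -> T -> R)
  (g : 'I_k -> 'I_(2 * D) -> int -> T -> 'I_(2 ^ b)) (w : T) : nat :=
  (\sum_(j < k) (hashed_gcws p u r c beta g j w == hashed_gcws p v r c beta g j w))%N.

End Defs.

(* Main.v *)
(** Conditionally on the hash values, the inner product is
    a + sum_(i <> i') x_i y_i' s_i s_i' 1{h(i) = h(i')}: the signs center the
    off-diagonal sum, and in its square only the pairs (i, i') and (i', i) survive,
    which gives the conditional mean and variance. The random inputs of the k GCWS
    runs, hash functions included, form k blocks that are independent, identically
    distributed and independent of the sketch randomness (pi-lambda argument on
    cylinders), so the joint law of all hash values and sketch variables is a finite
    product and every remaining quantity is a finite sum against it. *)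

Require Import Defs.
From HB Require Import structures.
From mathcomp Require Import all_boot all_order all_algebra.
From mathcomp Require Import all_classical all_reals all_analysis.
From mathcomp Require Import measurable_realfun.
From mathcomp Require Import ring lra.
Import Order.TTheory GRing.Theory Num.Theory.
Import numFieldNormedType.Exports.
Local Open Scope classical_set_scope.
Local Open Scope ring_scope.

(** * Means under product weights *)

(** This is why blocks take values in a function space with the cylinder sigma-algebra, and why hash
    events are countable unions over [(i, t)]. The probability of a match is never computed: the
    laws of [r], [c], [beta] and [g] do not depend on [j], which makes it the same in every block,
    and from then on only the law [q] of one pair of hash values matters. Both variances come from a
    single second moment about an arbitrary centre [x]: the choice [x = a] gives the conditional
    variance, [x = k * Pb] the unconditional one. The term [-2a] is the deterministic diagonal,
    removed from sums over all pairs of positions. *)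

Section FfunMean.
Context {R : realFieldType} {I V : finType} (q : V -> R).

Definition ffun_mean (f : {ffun I -> V} -> R) : R :=
  \sum_(t : {ffun I -> V}) (\prod_i q (t i)) * f t.

Lemma eq_ffun_mean f1 f2 : f1 =1 f2 -> ffun_mean f1 = ffun_mean f2.
Proof. by move=> e; apply: eq_bigr => t _; rewrite e. Qed.

Lemma ffun_mean_sum (J : finType) (p : pred J) (f : J -> {ffun I -> V} -> R) :
  ffun_mean (fun t => \sum_(j | p j) f j t) = \sum_(j | p j) ffun_mean (f j).
Proof. by rewrite exchange_big; apply: eq_bigr => t _; rewrite mulr_sumr. Qed.

Lemma ffun_meanZ a f : ffun_mean (fun t => a * f t) = a * ffun_mean f.
Proof. by rewrite mulr_sumr; apply: eq_bigr => t _; rewrite mulrCA. Qed.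

Lemma ffun_meanD f1 f2 :
  ffun_mean (fun t => f1 t + f2 t) = ffun_mean f1 + ffun_mean f2.
Proof. by rewrite -big_split; apply: eq_bigr => t _; rewrite mulrDr. Qed.

(** Independence of the coordinates in algebraic form: it is the distributivity of products over
    sums. *)
Lemma ffun_mean_prod (F : I -> V -> R) :
  ffun_mean (fun t => \prod_i F i (t i)) = \prod_i \sum_v q v * F i v.
Proof. by rewrite bigA_distr_bigA; apply: eq_bigr => t _; rewrite big_split. Qed.

Hypothesis q1 : \sum_v q v = 1.

Lemma ffun_mean_cst a : ffun_mean (fun=> a) = a.
Proof.
rewrite /ffun_mean -mulr_suml -(bigA_distr_bigA (fun=> q)).
by rewrite big1 ?mul1r// => i _.
Qed.

(** A function of one coordinate is a product whose other factors are 1, and each of those averages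
    to the total mass 1. *)
Lemma ffun_mean_coord i (f : V -> R) :
  ffun_mean (fun t => f (t i)) = \sum_v q v * f v.
Proof.
pose F l v := if l == i then f v else 1.
rewrite (@eq_ffun_mean _ (fun t => \prod_l F l (t l))); last first.
  move=> t; rewrite (bigD1 i)//= /F eqxx big1 ?mulr1// => l /negPf -> //.
rewrite ffun_mean_prod (bigD1 i)//= [X in _ * X]big1 ?mulr1 => [|l /negPf li].
  by apply: eq_bigr => v _; rewrite /F eqxx.
by rewrite -[RHS]q1; apply: eq_bigr => v _; rewrite /F li mulr1.
Qed.

Lemma ffun_mean_coord2 i j (f g : V -> R) : i != j ->
  ffun_mean (fun t => f (t i) * g (t j)) =
  (\sum_v q v * f v) * (\sum_v q v * g v).
Proof.
move=> ij; have ji : (j == i) = false by rewrite eq_sym (negPf ij).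
pose F l v := if l == i then f v else if l == j then g v else 1.
rewrite (@eq_ffun_mean _ (fun t => \prod_l F l (t l))); last first.
  move=> t; rewrite (bigD1 i)//= (bigD1 j) 1?eq_sym//= /F !eqxx ji.
  by rewrite big1 ?mulr1// => l /andP[/negPf -> /negPf ->].
rewrite ffun_mean_prod (bigD1 i)//= (bigD1 j) 1?eq_sym//= [X in _ * (_ * X)]big1 ?mulr1.
  congr (_ * _); apply: eq_bigr => v _; rewrite /F ?eqxx ?ji ?eqxx //.
move=> l /andP[/negPf li /negPf lj].
by rewrite -[RHS]q1; apply: eq_bigr => v _; rewrite /F li lj mulr1.
Qed.

End FfunMean.

(** * Number of coordinates satisfying a predicate: binomial law and first two moments *)

Section Matches.
Context {R : realFieldType} {I V : finType} (q : V -> R) (m : pred V).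
Hypothesis q1 : \sum_v q v = 1.
Let pm : R := \sum_v q v * (m v)%:R.

(** Split according to the exact set [A] of matching coordinates: every [A] of size [n] has the same
    weight, and there are binomially many. For [n > #|I|] both sides vanish, so the truncated
    subtraction in the exponent is harmless. *)
Lemma ffun_mean_count (n : nat) :
  ffun_mean q (fun t : {ffun I -> V} => ((\sum_i m (t i))%N == n)%:R) =
  'C(#|I|, n)%:R * pm ^+ n * (1 - pm) ^+ (#|I| - n).
Proof.
(* The product of [F A i (t i)] over [i] is the indicator that the matching set of [t] is exactly
   [A], and it is already in product form. *)
pose F (A : {set I}) i v : R := (m v == (i \in A))%:R.
have E (t : {ffun I -> V}) : ((\sum_i m (t i))%N == n)%:R =
    \sum_(A : {set I} | #|A| == n) \prod_i F A i (t i).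
  pose M : {set I} := finset (fun i => m (t i)).
  have cM : #|M| = (\sum_i m (t i))%N.
    rewrite -sum1_card big_mkcond; apply: eq_bigr => i _.
    by rewrite finset.in_set; case: (m _).
  have FM A : \prod_i F A i (t i) = (A == M)%:R.
    have [->|/eqP AM] := eqVneq A M.
      by rewrite big1// => i _; rewrite /F finset.in_set eqxx.
    have [i iA] : exists i, (i \in A) != (i \in M).
      apply/existsP; apply: contra_notT AM.
      rewrite negb_exists => /forallP e; apply/setP => i.
      by apply/eqP; rewrite -[_ == _]negbK e.
    by rewrite (bigD1 i)//= /F; move: iA; rewrite finset.in_set eq_sym => /negPf ->; rewrite mul0r.
  rewrite -cM; under eq_bigr do rewrite FM.
  rewrite big_mkcond (bigD1 M)//= eqxx big1 ?addr0; first by case: eqP.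
  by move=> A /negPf ->; case: ifP.
under eq_ffun_mean do rewrite E.
rewrite ffun_mean_sum.
have S (A : {set I}) : #|A| == n -> ffun_mean q (fun t => \prod_i F A i (t i)) =
   pm ^+ n * (1 - pm) ^+ (#|I| - n).
  move=> /eqP An; rewrite ffun_mean_prod (bigID (mem A))/=; congr (_ * _).
    rewrite (eq_bigr (fun=> pm)) ?prodr_const ?An// => i iA.
    by apply: eq_bigr => v _; rewrite /F iA eqb_id.
  rewrite (eq_bigr (fun=> 1 - pm)).
    rewrite (eq_bigl (mem (~: A))) => [|i]; last by rewrite -[RHS]/(i \in ~: A) finset.in_setC.
    by rewrite prodr_const cardsCs finset.setCK An.
  move=> i /negPf iA; rewrite -[X in X - _]q1 /pm -sumrB.
  by apply: eq_bigr => v _; rewrite /F iA; case: (m v); rewrite /=; ring.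
rewrite (eq_bigr _ S) -mulrA sumr_const -[LHS]mulr_natl; congr (_ * _).
by congr (_ %:R); rewrite -card_draws; apply: eq_card => A; rewrite finset.in_set.
Qed.

Lemma ffun_mean_matches :
  ffun_mean q (fun t : {ffun I -> V} => (\sum_i m (t i))%N%:R) = #|I|%:R * pm.
Proof.
under eq_ffun_mean do rewrite natr_sum.
rewrite ffun_mean_sum; under eq_bigr do rewrite (ffun_mean_coord q q1 _ (fun v => (m v)%:R)).
by rewrite sumr_const mulr_natl.
Qed.

(** In the squared sum of indicators the diagonal terms are idempotent, and the ordered pairs of
    distinct coordinates are independent. *)
Lemma ffun_mean_matches_sqr :
  ffun_mean q (fun t : {ffun I -> V} => (\sum_i m (t i))%N%:R ^+ 2) =
  #|I|%:R * pm + #|I|%:R * (#|I|%:R - 1) * pm ^+ 2.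
Proof.
have E (t : {ffun I -> V}) : (\sum_i m (t i))%N%:R ^+ 2 =
    \sum_i ((m (t i))%:R + \sum_(j | j != i) (m (t i))%:R * (m (t j))%:R) :> R.
  rewrite natr_sum expr2 mulr_suml; apply: eq_bigr => i _.
  rewrite mulr_sumr (bigD1 i)//=; congr (_ + _).
  by case: (m _); rewrite ?mulr1 ?mulr0.
under eq_ffun_mean do rewrite E.
rewrite ffun_mean_sum (eq_bigr (fun=> pm + (#|I|%:R - 1) * pm ^+ 2)).
  by rewrite sumr_const -mulr_natl; ring.
move=> i _; rewrite ffun_meanD (ffun_mean_coord q q1 _ (fun v => (m v)%:R)); congr (_ + _).
rewrite ffun_mean_sum (eq_bigr (fun=> pm ^+ 2)); last first.
  move=> j ji; rewrite (ffun_mean_coord2 q q1 _ _ (fun v => (m v)%:R) (fun v => (m v)%:R)) ?expr2//.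
  by rewrite eq_sym.
have cI : (0 < #|I|)%N by apply/card_gt0P; exists i.
by rewrite sumr_const cardC1 -[LHS]mulr_natl -subn1 natrB.
Qed.
End Matches.

(** * Averages of products of independent uniform signs *)

Section Signs.
Context {R : realFieldType} {I : finType}.
Let half := (fun _ : bool => 2^-1 : R).
Definition flip (i : I) (s : {ffun I -> bool}) : {ffun I -> bool} :=
  [ffun m => s m (+) (m == i)].

Lemma flipK i : involutive (flip i).
Proof. by move=> s; apply/ffunP => m; rewrite !ffunE addbK. Qed.

Lemma sum_half : \sum_v half v = 1 :> R.
Proof. by rewrite big_bool/= /half; lra. Qed.

(** Flipping sign [i] is a bijection preserving the uniform weight, so the mean of a function odd
    under it equals its own opposite. *)
Lemma sign_mean_odd i (f : {ffun I -> bool} -> R) :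
  (forall s, f (flip i s) = - f s) -> ffun_mean half f = 0.
Proof.
move=> fi; suff : ffun_mean half f = - ffun_mean half f by move=> ?; lra.
rewrite {1}/ffun_mean (reindex_inj (can_inj (flipK i))) -sumrN.
by apply: eq_bigr => s _; rewrite fi mulrN.
Qed.

Lemma sign_flip i m (s : {ffun I -> bool}) :
  (-1) ^+ flip i s m = (if m == i then -1 else 1) * (-1) ^+ s m :> R.
Proof. by rewrite ffunE; case: (s m); case: (m == i); rewrite /= !(mul1r,mulr1,mulN1r,opprK). Qed.

Lemma sign_mean2 i j : i != j ->
  ffun_mean half (fun s : {ffun I -> bool} => (-1) ^+ s i * (-1) ^+ s j) = 0 :> R.
Proof.
move=> ij; apply: (@sign_mean_odd i) => s.
by rewrite !sign_flip eqxx (eq_sym j) (negPf ij) mul1r mulN1r mulNr.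
Qed.

(** The mean vanishes as soon as some index occurs an odd number of times. Since [i != j] and
    [k != l], the only even patterns are the two ways of matching [(k, l)] with [(i, j)], and they
    exclude each other. *)
Lemma sign_mean4 i j k l : i != j -> k != l ->
  ffun_mean half (fun s : {ffun I -> bool} =>
     ((-1) ^+ s i * (-1) ^+ s j) * ((-1) ^+ s k * (-1) ^+ s l)) =
  ((k, l) == (i, j))%:R + ((k, l) == (j, i))%:R :> R.
Proof.
move=> ij kl; rewrite !xpair_eqE.
have ss (b : bool) : (-1) ^+ b * (-1) ^+ b = 1 :> R by case: b; rewrite ?mulrNN mulr1.
have ji : (j == i) = false by rewrite eq_sym (negPf ij).
have [ki|ki] := eqVneq k i.
  subst k; rewrite (negPf ij)/=; have [->|lj] := eqVneq l j.
    rewrite (eq_ffun_mean _ _ (fun=> 1)) ?ffun_mean_cst ?sum_half ?addr0// => s.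
    by rewrite mulrACA !ss mulr1.
  rewrite addr0; apply: (@sign_mean_odd j) => s; rewrite !sign_flip eqxx (negPf ij) (negPf lj).
  by ring.
have [li|li] := eqVneq l i.
  subst l; rewrite (negPf ij)/= andbT add0r; have [->|kj] := eqVneq k j.
    rewrite (eq_ffun_mean _ _ (fun=> 1)) ?ffun_mean_cst ?sum_half ?addr0// => s.
    by rewrite (mulrC (_ ^+ s j)) mulrACA !ss mulr1.
  apply: (@sign_mean_odd j) => s; rewrite !sign_flip eqxx (negPf ij) (negPf kj).
  by ring.
rewrite andbF addr0; apply: (@sign_mean_odd i) => s.
by rewrite !sign_flip eqxx ji (negPf ki) (negPf li); ring.
Qed.
End Signs.

(** * Count-sketch of one-hot vectors *)

(** Euclidean division by [c] undoes the layout of [onehot_cat]: the quotient is the block, the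
    remainder the position inside it. *)
Lemma sum_ord_divmod (V : nmodType) (c k : nat) (F : nat -> nat -> V) : (0 < c)%N ->
  \sum_(m < c * k) F (m %/ c)%N (m %% c)%N = \sum_(j < k) \sum_(l < c) F j l.
Proof.
move=> c0; rewrite -(big_mkord xpredT (fun m => F (m %/ c)%N (m %% c)%N)).
rewrite mulnC big_nat_mul big_mkord; apply: eq_bigr => j _.
rewrite -{1}[(j * c)%N]add0n big_addn mulSn addnK big_mkord.
apply: eq_bigr => l _.
by rewrite addnC divnMDl// divn_small// addn0 modnMDl modn_small.
Qed.

Lemma sum_diag (V : nmodType) (I : finType) (F : I * I -> V) :
  \sum_(p | p.1 == p.2) F p = \sum_i F (i, i).
Proof.
rewrite (eq_bigr (fun p => F (p.1, p.2))) => [|[] //].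
rewrite -(pair_big_dep xpredT (fun i j => i == j) (fun i j => F (i, j))) /=.
by apply: eq_bigr => i _; rewrite (big_pred1 i) => // j; rewrite eq_sym.
Qed.

Section OneHot.
Context {R : realType} (b k : nat).
Implicit Types th : 'I_k -> 'I_(2 ^ b).

(** Within a block, two unit vectors have inner product 1 or 0 according to whether the hash values
    agree. *)
Lemma sum_onehot_cat_mul th1 th2 :
  \sum_m (onehot_cat (fun j => Some (th1 j)) m : R) * onehot_cat (fun j => Some (th2 j)) m =
  (\sum_j (th1 j == th2 j))%N%:R.
Proof.
pose G th j l : R := match (insub j : option 'I_k) with
  | Some j' => (val (th j') == l)%:R | None => 0 end.
rewrite (sum_ord_divmod _ _ _ (fun j l => G th1 j l * G th2 j l)) ?expn_gt0//.
rewrite natr_sum; apply: eq_bigr => j _; rewrite /G !valK.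
rewrite (bigD1 (th1 j))//= eqxx mul1r eq_sym big1 ?addr0// => l.
by rewrite -val_eqE /= eq_sym => /negPf ->; rewrite mul0r.
Qed.

Lemma onehot_cat_sqr th m :
  (onehot_cat (fun j => Some (th j)) m : R) ^+ 2 = onehot_cat (fun j => Some (th j)) m.
Proof.
rewrite /onehot_cat; case: insub => [j|]; last by rewrite expr0n.
by case: eqP; rewrite ?expr1n ?expr0n.
Qed.

Lemma sum_onehot_cat_sqr th :
  \sum_m (onehot_cat (fun j => Some (th j)) m : R) ^+ 2 = k%:R.
Proof.
under eq_bigr do rewrite expr2.
rewrite sum_onehot_cat_mul; congr (_ %:R).
by rewrite (eq_bigr (fun=> 1%N)) ?sum1_card ?card_ord// => j _; rewrite eqxx.
Qed.
End OneHot.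

Lemma sum_inv_card (R : realType) (B : nat) : (0 < B)%N ->
  \sum_(c < B) B%:R^-1 = 1 :> R.
Proof.
move=> B0.
by rewrite sumr_const card_ord -[_ *+ _]mulr_natl divff// pnatr_eq0 -lt0n.
Qed.

Section CountSketch.
Context {R : realType} (n B : nat).
Hypothesis B0 : (0 < B)%N.
Implicit Types x y : 'I_n -> R.

(** Expectation over independent bins and signs. The signs are averaged inside, with the bins
    frozen, because cancellation comes from them alone. *)
Definition sketch_mean (f : {ffun 'I_n -> 'I_B} -> {ffun 'I_n -> bool} -> R) : R :=
  ffun_mean (fun=> B%:R^-1) (fun h => ffun_mean (fun=> 2^-1) (f h)).

Let sum_invB := sum_inv_card R B B0.

(** Sum over the common bin: [B] possibilities, each of probability [B^-2]. *)
Lemma mean_collision (i j : 'I_n) : i != j ->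
  ffun_mean (fun=> B%:R^-1) (fun h : {ffun 'I_n -> 'I_B} => (h i == h j)%:R) =
  B%:R^-1 :> R.
Proof.
move=> ij.
have E (h : {ffun 'I_n -> 'I_B}) :
    (h i == h j)%:R = \sum_(c < B) (h i == c)%:R * (h j == c)%:R :> R.
  rewrite (bigD1 (h i))//= eqxx mul1r eq_sym big1 ?addr0// => c.
  by rewrite eq_sym => /negPf ->; rewrite mul0r.
under eq_ffun_mean do rewrite E.
have D (c : 'I_B) : \sum_v B%:R^-1 * (v == c)%:R = B%:R^-1 :> R.
  rewrite (bigD1 c)//= eqxx mulr1 big1 ?addr0// => v /negPf ->.
  by rewrite mulr0.
rewrite ffun_mean_sum (eq_bigr (fun=> B%:R^-1 * B%:R^-1)); last first.
  move=> c _.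
  by rewrite (ffun_mean_coord2 _ sum_invB _ _ (fun v => (v == c)%:R) (fun v => (v == c)%:R))// D.
by rewrite -mulr_suml sum_invB mul1r.
Qed.

Lemma dotB_count_sketch h s x y :
  dotB (count_sketch h s x : 'I_B -> R) (count_sketch h s y) =
  \sum_p x p.1 * y p.2 * (h p.1 == h p.2)%:R * ((-1) ^+ s p.1 * (-1) ^+ s p.2).
Proof.
rewrite /dotB /count_sketch.
under eq_bigr do rewrite big_distrlr /= pair_big /=.
rewrite exchange_big; apply: eq_bigr => -[i j] _ /=.
rewrite (bigD1 (h i))//= eqxx [X in _ + X]big1 => [|m /negPf mi].
  by rewrite (eq_sym (h j)) /=; ring.
by rewrite (eq_sym (h i)) mi mulr0 mul0r.
Qed.

(* The diagonal of the double sum is deterministic; the signs make the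
   off-diagonal part centered. *)
Lemma dotB_count_sketch_centered h s x y :
  dotB (count_sketch h s x : 'I_B -> R) (count_sketch h s y) - \sum_i x i * y i =
  \sum_(p | p.1 != p.2)
    x p.1 * y p.2 * (h p.1 == h p.2)%:R * ((-1) ^+ s p.1 * (-1) ^+ s p.2).
Proof.
rewrite dotB_count_sketch (bigID (fun p => p.1 == p.2))/= sum_diag.
rewrite addrAC [X in X + _](_ : _ = 0) ?add0r// -sumrB big1// => i _.
by rewrite eqxx mulr1; case: (s i); rewrite ?mulrNN !mulr1 subrr.
Qed.

Lemma sketch_mean_dotB x y :
  sketch_mean (fun h s => dotB (count_sketch h s x) (count_sketch h s y)) =
  \sum_i x i * y i.
Proof.
rewrite /sketch_mean -[RHS](ffun_mean_cst (I := 'I_n) _ sum_invB); apply: eq_ffun_mean => h.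
rewrite (eq_ffun_mean _ _ (fun s : {ffun _ -> bool} => \sum_i x i * y i + 1 *
  \sum_(p | p.1 != p.2) x p.1 * y p.2 * (h p.1 == h p.2)%:R * ((-1) ^+ s p.1 * (-1) ^+ s p.2))).
  rewrite ffun_meanD ffun_mean_cst ?sum_half// ffun_meanZ ffun_mean_sum [X in _ + 1 * X]big1 ?mulr0 ?addr0// => p p12.
  by rewrite ffun_meanZ sign_mean2 ?mulr0.
by move=> s; rewrite -dotB_count_sketch_centered mul1r subrKC.
Qed.

(** For fixed bins, averaging the signs in the squared off-diagonal sum pairs each [p] only with
    itself and with its swap, which is distinct from [p] off the diagonal. Both carry the same
    collision indicator, whose mean is [B^-1]. *)
Lemma sketch_mean_dotB_centered_sqr x y :
  sketch_mean (fun h s => (dotB (count_sketch h s x) (count_sketch h s y)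
                          - \sum_i x i * y i) ^+ 2) =
  B%:R^-1 * ((\sum_i x i ^+ 2) * (\sum_i y i ^+ 2) + (\sum_i x i * y i) ^+ 2
             - 2 * \sum_i (x i * y i) ^+ 2).
Proof.
pose C (p : 'I_n * 'I_n) := x p.1 * y p.2.
transitivity (ffun_mean (fun=> B%:R^-1) (fun h : {ffun 'I_n -> 'I_B} =>
   \sum_(p | p.1 != p.2) (C p ^+ 2 + C p * C (p.2, p.1)) * (h p.1 == h p.2)%:R)).
  apply: eq_ffun_mean => h.
  transitivity (ffun_mean (fun=> 2^-1) (fun s : {ffun 'I_n -> bool} =>
    \sum_(p | p.1 != p.2) \sum_(p' | p'.1 != p'.2)
     (C p * (h p.1 == h p.2)%:R) * (C p' * (h p'.1 == h p'.2)%:R) *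
     (((-1) ^+ s p.1 * (-1) ^+ s p.2) * ((-1) ^+ s p'.1 * (-1) ^+ s p'.2)))).
    apply: eq_ffun_mean => s; rewrite dotB_count_sketch_centered expr2 big_distrlr/=.
    by apply: eq_bigr => p _; apply: eq_bigr => p' _; rewrite mulrACA.
  rewrite ffun_mean_sum; apply: eq_bigr => p p12; rewrite ffun_mean_sum.
  transitivity (\sum_(p' | p'.1 != p'.2) (C p * (h p.1 == h p.2)%:R) *
     (C p' * (h p'.1 == h p'.2)%:R) * ((p' == p)%:R + (p' == (p.2, p.1))%:R)).
    by apply: eq_bigr => -[k l] /= kl; rewrite ffun_meanZ sign_mean4.
  have pp : p != (p.2, p.1) by case: (p) p12 => i j /=; rewrite xpair_eqE => /negPf ->.
  have pp' : ((p.2, p.1) == p) = false by rewrite eq_sym (negPf pp).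
  rewrite (bigD1 p)//= (bigD1 (p.2, p.1)) /=; last by rewrite eq_sym p12 pp'.
  rewrite !eqxx pp' (negPf pp) big1; last first.
    by move=> p' /andP[/andP[_ /negPf ->] /negPf ->]; rewrite addr0 mulr0.
  by rewrite (eq_sym (h p.2)); case: (h p.1 == h p.2) => /=; ring.
rewrite ffun_mean_sum.
rewrite (eq_bigr (fun p => B%:R^-1 * (C p ^+ 2 + C p * C (p.2, p.1)))); last first.
  by move=> p p12; rewrite ffun_meanZ mean_collision// mulrC.
rewrite -mulr_sumr; congr (_ * _).
(* Over all pairs the sum factors. On the diagonal the two terms coincide with [(x i * y i) ^+ 2],
   whence the correction with factor 2. *)
have all_pairs : \sum_p (C p ^+ 2 + C p * C (p.2, p.1)) =
    (\sum_i x i ^+ 2) * (\sum_i y i ^+ 2) + (\sum_i x i * y i) ^+ 2.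
  rewrite expr2 !big_distrlr !pair_big -big_split; apply: eq_bigr => -[i j] _ /=.
  by rewrite /C /=; ring.
rewrite -all_pairs [X in _ = X - _](bigID (fun p => p.1 == p.2))/= sum_diag.
rewrite addrAC [X in _ = X + _](_ : _ = 0) ?add0r//.
by rewrite mulr_sumr -sumrB big1// => i _; rewrite /C/=; ring.
Qed.
End CountSketch.

(** * Independent blocks of random variables *)

(** Rectangles constraining finitely many coordinates: a pi-system generating the product
    sigma-algebra. The coordinates form a finite list because [L] itself will be infinite, one
    coordinate per integer [t]. *)
Definition cylinder (R : realType) (L : eqType) : set (set (L -> R)) :=
  [set C | exists s : seq L, exists A : L -> set R,
    [/\ uniq s, forall l, measurable (A l) &
        C = [set f | forall l, l \in s -> A l (f l)]]].

Definition cylinder_space (R : realType) (L : eqType) :=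
  g_sigma_algebraType (cylinder R L).

Lemma cylinderI (R : realType) (L : eqType) : setI_closed (cylinder R L).
Proof.
move=> _ _ [s1 [A1 [u1 m1 ->]]] [s2 [A2 [u2 m2 ->]]].
exists (undup (s1 ++ s2)).
exists (fun l => (if l \in s1 then A1 l else setT) `&` (if l \in s2 then A2 l else setT)).
split; first exact: undup_uniq.
  by move=> l; apply: measurableI; case: ifP.
apply/seteqP; split=> f /=.
  by move=> [h1 h2] l _; split; case: ifP => // ls; [exact: h1|exact: h2].
move=> h; split=> l ls.
  by have := h l; rewrite mem_undup mem_cat ls => /(_ isT)[].
by have := h l; rewrite mem_undup mem_cat ls orbT => /(_ isT)[_].
Qed.

Lemma cylinderT (R : realType) (L : eqType) : cylinder R L setT.
Proof. by exists [::], (fun=> setT); split=> //; apply/seteqP; split. Qed.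

Lemma measurable_coordinate (R : realType) (L : eqType) (l : L) :
  measurable_fun setT (fun f : cylinder_space R L => f l).
Proof.
move=> _ A mA; rewrite setTI; apply: sub_sigma_algebra.
exists [:: l], (fun=> A); split=> //; apply/seteqP; split=> f /=.
  by move=> fA l'; rewrite inE => /eqP ->.
by apply; rewrite inE.
Qed.

Section Blocks.
Context {R : realType} {d : measure_display} {T : measurableType d}.
Variables (P : probability T R) (k : nat) (L M : eqType).
Variable X : ('I_k * L + M)%type -> T -> R.
Hypothesis indX : mutually_independent P X.

Definition block (j : 'I_k) (w : T) : cylinder_space R L := fun l => X (inl (j, l)) w.

Let mX i : measurable_fun setT (X i). Proof. by case: indX. Qed.

Let mXpre i (A : set R) : measurable A -> measurable (X i @^-1` A).
Proof. by move=> mA; rewrite -[_ @^-1` _]setTI; exact: mX. Qed.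

Lemma measurable_block j : measurable_fun setT (block j).
Proof.
apply: (@measurability _ _ _ (cylinder_space R L) _ _ (cylinder R L)) => // _ [_ [s [A [us mA ->]]] <-].
rewrite setTI.
rewrite (_ : _ @^-1` _ = \bigcap_(l in [set` s]) (X (inl (j, l)) @^-1` A l))//.
by apply: fin_bigcap_measurable => // l _; exact: mXpre.
Qed.

Let mblock j C : measurable C -> measurable (block j @^-1` C).
Proof. by move=> mC; rewrite -[_ @^-1` _]setTI; exact: measurable_block. Qed.

Variables (rs : seq M) (D : M -> set R).
Hypotheses (urs : uniq rs) (mD : forall m, measurable (D m)).

Let rest : set T := [set w | forall m, m \in rs -> D m (X (inr m) w)].

Let mrest : measurable rest.
Proof.
rewrite (_ : rest = \bigcap_(m in [set` rs]) (X (inr m) @^-1` D m))//.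
by apply: fin_bigcap_measurable => // m _; exact: mXpre.
Qed.

Let pr A := fine (P A).

Let prE A : measurable A -> P A = (pr A)%:E.
Proof. by move=> mA; rewrite fineK// fin_num_measure. Qed.

Let joint (C : 'I_k -> set (cylinder_space R L)) : set T :=
  [set w | (forall j, C j (block j w)) /\ rest w].

Let prod_rest : R := \prod_(m <- rs) pr (X (inr m) @^-1` D m).

Let finite_product (s : seq ('I_k * L + M)) (A : 'I_k * L + M -> set R) :
  uniq s -> (forall i, measurable (A i)) ->
  P [set w | forall i, i \in s -> A i (X i w)] =
  (\prod_(i <- s) pr (X i @^-1` A i))%:E.
Proof.
move=> us mA; have [_ /(_ s A us mA) H] := indX.
rewrite -prodEFin (eq_bigr (fun i => P (X i @^-1` A i))) ?H// => i _.
by rewrite prE//; exact: mXpre.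
Qed.

Lemma cylinder_block_prob j s (A : L -> set R) : uniq s -> (forall l, measurable (A l)) ->
  fine (P (block j @^-1` [set f | forall l, l \in s -> A l (f l)])) =
  \prod_(l <- s) fine (P (X (inl (j, l)) @^-1` A l)).
Proof.
move=> us mA.
pose B (i : 'I_k * L + M) := if i is inl (_, l) then A l else setT.
have mB i : measurable (B i) by case: i => [[? ?]|?] /=.
have := finite_product (map (fun l => inl (j, l)) s) B.
rewrite map_inj_uniq; last by move=> l l' [].
rewrite big_map => /(_ us) H.
rewrite (_ : _ @^-1` _ = [set w | forall i, i \in map (fun l => inl (j, l)) s -> B i (X i w)]).
  by rewrite H.
apply/seteqP; split=> w /=.
  by move=> h _ /mapP[l ls ->] /=; exact: h.
by move=> h l ls; apply: (h (inl (j, l))); apply/mapP; exists l.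
Qed.

(** The constraints of the blocks and of [rest] bear on distinct primitive variables, so together
    they form one finite rectangle, to which mutual independence applies directly. *)
Lemma joint_cylinders C : (forall j, cylinder R L (C j)) ->
  P (joint C) = (\prod_j pr (block j @^-1` C j) * prod_rest)%:E.
Proof.
move=> cC; have {cC}/choice[sA HC] : forall j, exists sA : seq L * (L -> set R),
    [/\ uniq sA.1, forall l, measurable (sA.2 l) &
        C j = [set f | forall l, l \in sA.1 -> sA.2 l (f l)]].
  by move=> j; have [s [A H]] := cC j; exists (s, A).
have us j : uniq (sA j).1 by case: (HC j).
have mA j : forall l, measurable ((sA j).2 l) by case: (HC j).
have {HC}CE j : C j = [set f | forall l, l \in (sA j).1 -> (sA j).2 l (f l)].
  by case: (HC j).
pose bs := [seq (inl (j, l) : ('I_k * L + M)%type) | j <- enum 'I_k, l <- (sA j).1].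
pose ms := [seq (inr m : ('I_k * L + M)%type) | m <- rs].
pose A (i : 'I_k * L + M) := match i with inl (j, l) => (sA j).2 l | inr m => D m end.
have u : uniq (bs ++ ms).
  rewrite cat_uniq; apply/and3P; split.
  - apply: allpairs_uniq_dep => //; first exact: enum_uniq.
    by move=> [j l] [j' l'] _ _ /= [-> ->].
  - apply/hasPn => _ /mapP[m _ ->] /=.
    by apply/negP => /allpairsPdep[j [l [_ _]]].
  - by rewrite map_inj_uniq// => m m' [].
rewrite (_ : joint C = [set w | forall i, i \in bs ++ ms -> A i (X i w)]).
  rewrite finite_product//; last by case=> [[j l]|m] /=.
  congr (_%:E); rewrite big_cat/= big_map; congr (_ * _).
  rewrite big_allpairs_dep big_enum/=; apply: eq_bigr => j _.
  by rewrite CE [RHS]cylinder_block_prob.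
apply/seteqP; split=> w /=.
  move=> [hC hr] i; rewrite mem_cat => /orP[].
    move=> /allpairsPdep[j [l [_ ls ->]]] /=.
    by have := hC j; rewrite CE/=; exact.
  by move=> /mapP[m mr ->] /=; exact: hr.
move=> h; split=> [j|m mr].
  rewrite CE /= => l ls; apply: (h (inl (j, l))).
  rewrite mem_cat; apply/orP; left; apply/allpairsPdep.
  by exists j, l; split=> //; rewrite mem_enum.
by apply: (h (inr m)); rewrite mem_cat map_f ?orbT.
Qed.

Lemma block_independence (C : 'I_k -> set (cylinder_space R L)) :
  (forall j, measurable (C j)) ->
  P [set w | (forall j, C j (block j w)) /\
             (forall m, m \in rs -> D m (X (inr m) w))] =
  (\prod_j fine (P (block j @^-1` C j)) *
   \prod_(m <- rs) fine (P (X (inr m) @^-1` D m)))%:E.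
Proof.
move=> mC; rewrite -/(joint C) -/prod_rest.
(* Generalized for induction: the list contains the blocks allowed an arbitrary measurable set,
   while the others must carry cylinders. For the full list this requirement is vacuous; for the
   empty list it is the cylinder case. *)
have : forall j, j \notin enum 'I_k -> cylinder R L (C j).
  by move=> j; rewrite mem_enum.
(* Cylinders are replaced by arbitrary measurable sets one block at a time:
   two measures agreeing on a pi-system agree on its sigma-algebra. *)
elim: (enum 'I_k) C mC => [|j0 S IH] C mC cC.
  by apply: joint_cylinders => j; exact: cC.
(* Everything except block [j0] is frozen in [F], so that the joint probability becomes a measure in
   the set [E] imposed on that block. *)
pose F : set T := [set w | (forall j, j != j0 -> C j (block j w)) /\ rest w].
pose CE E j := if j == j0 then E else C j.
have jointE E : joint (CE E) = block j0 @^-1` E `&` F.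
  apply/seteqP; split=> w /=.
    move=> [hC hr]; split; first by have := hC j0; rewrite /CE eqxx.
    by split=> // j /negPf jj0; have := hC j; rewrite /CE jj0.
  move=> [hE [hC hr]]; split=> // j; rewrite /CE; case: eqVneq => [->//|].
  exact: hC.
have mF : measurable F.
  rewrite (_ : F = joint (CE setT)); last by rewrite jointE preimage_setT setTI.
  rewrite (_ : joint _ = (\bigcap_(j in [set: 'I_k]) (block j @^-1` CE setT j)) `&` rest).
    apply: measurableI => //; apply: fin_bigcap_measurable => // j _.
    by apply: mblock; rewrite /CE; case: ifP.
  by apply/seteqP; split=> w /= [hC hr]; split=> // j; [move=> _|]; exact: hC.
pose c := \prod_(j | j != j0) pr (block j @^-1` C j) * prod_rest.
have c0 : 0 <= c by apply: mulr_ge0; apply: prodr_ge0 => ? _; exact: fine_ge0.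
have prodE E : \prod_j pr (block j @^-1` CE E j) * prod_rest = c * pr (block j0 @^-1` E).
  rewrite (bigD1 j0)//= {1}/CE eqxx -mulrA mulrC; congr (_ * _ * _).
  by apply: eq_bigr => j /negPf jj0; rewrite /CE jj0.
suff main E : measurable E -> P (block j0 @^-1` E `&` F) = (c * pr (block j0 @^-1` E))%:E.
  have CCE : C = CE (C j0) by apply/funext => j; rewrite /CE; case: eqVneq => [->|].
  by rewrite [in LHS]CCE jointE main// -prodE -CCE.
pose G := preimage_set_system setT (block j0) (cylinder R L).
move=> mE.
have EG : <<s G >> (block j0 @^-1` E).
  by rewrite /G g_sigma_preimageE; exists E; rewrite ?setTI.
(* The two measures compared are [P] restricted to [F] and [c] times [P], on the sigma-algebra
   generated by block [j0]; nonnegativity of [c] makes the second one a measure. *)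
pose m2 := mscale (NngNum c0) P.
have m2E A : measurable A -> m2 A = (c * pr A)%:E.
  by move=> mA; rewrite /pr EFinM fineK// fin_num_measure.
have := @g_sigma_algebra_measure_unique _ R T G _ (fun=> setT) _ _ (mrestr P mF) m2 _ _ _ _ EG.
rewrite [X in _ -> X](_ : _ = (mrestr P mF (block j0 @^-1` E) = (c * pr (block j0 @^-1` E))%:E))//.
move=> ->; first by apply: m2E; exact: mblock.
- by move=> _ [B cB <-]; rewrite setTI; apply: mblock; exact: sub_sigma_algebra.
- by move=> _; exists setT; [exact: cylinderT|rewrite setTI preimage_setT].
- by rewrite bigcup_const//; exists 0%N.
- move=> _ _ [B cB <-] [B' cB' <-]; exists (B `&` B'); first exact: cylinderI.
  by rewrite !setTI preimage_setI.
- move=> _ [B cB <-].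
  have mB : measurable (B : set (cylinder_space R L)) by exact: sub_sigma_algebra.
  rewrite setTI; transitivity (c * pr (block j0 @^-1` B))%:E; last first.
    by apply/esym/m2E; exact: mblock.
  (* With the cylinder [B] in place of [C j0], block [j0] may leave the list, so the induction
     hypothesis applies. *)
  rewrite -prodE -IH; first by rewrite jointE.
    by move=> j; rewrite /CE; case: ifP.
  move=> j jS; rewrite /CE; case: eqVneq => // jj0.
  by apply: cC; rewrite inE negb_or jj0.
- move=> _; apply: (@le_lt_trans _ _ 1%E); last exact: ltry.
  by apply: probability_le1; exact: measurableI.
Qed.

End Blocks.
Arguments block {R d T k L M} X j w.

(** On cylinders the law of a block is a product of marginals, which agree for [j] and [j']; the
    pi-system then determines the whole law. *)
Lemma block_identically_distributed (R : realType) (d : measure_display)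
  (T : measurableType d) (P : probability T R) (k : nat) (L M : eqType)
  (X : ('I_k * L + M)%type -> T -> R) (indX : mutually_independent P X) (j j' : 'I_k) :
  (forall l A, measurable A ->
     P (X (inl (j, l)) @^-1` A) = P (X (inl (j', l)) @^-1` A)) ->
  forall C, measurable C -> P (block X j @^-1` C) = P (block X j' @^-1` C).
Proof.
move=> eqX C mC.
pose f i : {mfun T >-> cylinder_space R L} := mfun_Sub (mem_set (measurable_block _ _ _ _ _ indX i)).
have := @measure_unique _ R (cylinder_space R L) (cylinder R L) (fun=> setT) _ _ _ _
  (distribution P (f j)) (distribution P (f j')) _ _ C mC.
rewrite /distribution /pushforward /f !mfun_valP; apply => //.
- exact: cylinderI.
- by move=> _; exact: cylinderT.
- by rewrite bigcup_const//; exists 0%N.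
- move=> _ [s [A [us mA ->]]].
  have fm i : P (block X i @^-1` [set g | forall l, l \in s -> A l (g l)]) \is a fin_num.
    apply: fin_num_measure; rewrite -[_ @^-1` _]setTI; apply: (measurable_block P) => //.
    by apply: sub_sigma_algebra; exists s, A.
  transitivity (fine (P (block X j @^-1` [set g | forall l, l \in s -> A l (g l)])))%:E.
    by rewrite fineK.
  rewrite -[RHS](fineK (fm j')); congr (_%:E).
  by rewrite !(cylinder_block_prob P)//; apply: eq_bigr => l _; rewrite eqX.
- move=> _; apply: (@le_lt_trans _ _ 1%E); last exact: ltry.
  by apply: probability_le1; exact: measurableT.
Qed.

(** * Measurability of GCWS *)

(** Inversion is continuous off 0, and the remaining point is a measurable singleton. *)
Lemma measurable_inv (R : realType) : measurable_fun [set: R] (@GRing.inv R).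
Proof.
have mN0 : measurable [set x : R | x != 0] by exact: open_measurable.
rewrite (_ : setT = [set x : R | x != 0] `|` [set 0]); last first.
  by apply/seteqP; split=> x //= _; case: (eqVneq x 0) => ?; [right|left].
apply/measurable_funU => //; split; last exact: measurable_fun_set1.
apply: open_continuous_measurable_fun => //.
by move=> x; rewrite inE /= => x0; exact: inv_continuous.
Qed.

Lemma measurable_floor_eq (R : realType) (t : int) :
  measurable [set x : R | Num.floor x = t].
Proof.
rewrite (_ : [set _ | _] = `[t%:~R, (t + 1)%:~R[%classic); first exact: measurable_itv.
apply/seteqP; split=> x /=; rewrite in_itv /=.
  by move=> <-; exact: floor_itv.
by move=> /floor_def.
Qed.

Lemma measurable_floor (R : realType) :
  measurable_fun setT (fun x : R => (Num.floor x)%:~R : R).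
Proof.
move=> _ A mA; rewrite setTI.
rewrite (_ : _ @^-1` _ = \bigcup_(t : int)
  ([set x : R | Num.floor x = t] `&` (if t%:~R \in A then setT else set0))).
  apply: countable_bigcupT_measurable; first exact: countableP.
  move=> t; apply: measurableI; first exact: measurable_floor_eq.
  by case: ifP.
apply/seteqP; split=> x /=.
  by move=> xA; exists (Num.floor x) => //; split=> //; rewrite mem_set.
by move=> [t _ [<-]]; case: ifP => //; rewrite inE.
Qed.

(** The result of [pick] depends only on the truth table of [Q] at [w], and there are finitely many
    tables. Ties in the argmin thus need no separate treatment. *)
Lemma measurable_pick (d : measure_display) (T : measurableType d) (I : finType)
    (Q : I -> T -> bool) (i0 : I) :
  (forall i, measurable [set w | Q i w]) ->
  measurable [set w | [pick i | Q i w] = Some i0].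
Proof.
move=> mQ.
rewrite (_ : [set _ | _] =
  \bigcup_(q in [set q : {ffun I -> bool} | [pick i | q i] = Some i0])
    \bigcap_(i in [set: I]) [set w | Q i w = q i]).
  apply: fin_bigcup_measurable => // q _.
  apply: fin_bigcap_measurable => // i _.
  case: (q i); first exact: mQ.
  rewrite (_ : [set _ | _] = ~` [set w | Q i w]); first exact: measurableC.
  by apply/seteqP; split=> w /=; case: (Q i w).
apply/seteqP; split=> w /=.
  move=> H; exists [ffun i => Q i w]; last by move=> i _ /=; rewrite ffunE.
  by rewrite /= -H; apply: eq_pick => i; rewrite ffunE.
by move=> [q /= <- H]; apply: eq_pick => i; rewrite H.
Qed.

Section Gcws.
Context {R : realType} (D : nat) (p : R) (u : 'I_D -> R).

(** A nonzero entry [u i] shows up at position [2 * i] if positive and at [2 * i + 1] if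
    negative. *)
Lemma sign_split_gt0 : (exists i, u i != 0) -> exists i, 0 < sign_split u i.
Proof.
move=> [i ui]; have iD := ltn_ord i.
have lt0 : (2 * i < 2 * D)%N by rewrite ltn_pmul2l.
have lt1 : (2 * i + 1 < 2 * D)%N.
  by rewrite addn1 -[((2 * i).+2)%N]add2n -mulnS leq_pmul2l.
case: (ltrgtP (u i) 0) ui => // ui _.
  exists (Ordinal lt1); rewrite /sign_split /=.
  rewrite (_ : (2 * i + 1) %/ 2 = i)%N; last by rewrite mulnC divnMDl// addn0.
  by rewrite oddD oddM /= valK /= (ltW ui) oppr_gt0.
exists (Ordinal lt0); rewrite /sign_split /=.
by rewrite mulKn// oddM /= valK /= ui.
Qed.

(** A minimum over a nonempty finite set is attained, so [pick] succeeds for every outcome, not just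
    almost surely. *)
Lemma gcws_isSome r c beta : (exists i, u i != 0) -> gcws p u r c beta.
Proof.
move=> /sign_split_gt0[i0 ui0]; rewrite /gcws; case: pickP => // /= H.
have [i ui mi] := @arg_minP _ _ _ i0 (fun i => 0 < sign_split u i)
  (gcws_a p (sign_split u) r c beta) ui0.
have := H i; rewrite ui /= => /negP[]; apply/forallP => i'.
by apply/implyP => ui'; exact: mi.
Qed.

Context {d : measure_display} {T : measurableType d}.
Variables (r c beta : 'I_(2 * D) -> T -> R).
Hypotheses (mr : forall i, measurable_fun setT (r i))
  (mc : forall i, measurable_fun setT (c i))
  (mbeta : forall i, measurable_fun setT (beta i)).

Let mlevel (ut : 'I_(2 * D) -> R) i :
  measurable_fun setT (fun w => p * ln (ut i) / r i w + beta i w).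
Proof.
apply: measurable_funD => //; apply: measurable_funM => //.
by apply: measurableT_comp => //; exact: measurable_inv.
Qed.

Let mt ut i t : measurable [set w | gcws_t p ut (r ^~ w) (beta ^~ w) i = t].
Proof.
have := mlevel ut i measurableT _ (measurable_floor_eq R t).
by rewrite setTI.
Qed.

Let ma ut i : measurable_fun setT (fun w => gcws_a p ut (r ^~ w) (c ^~ w) (beta ^~ w) i).
Proof.
apply: measurable_funB; first exact: measurableT_comp.
apply: measurable_funM => //; apply: measurable_funB => //.
apply: measurable_funD => //.
exact: (measurableT_comp (measurable_floor R) (mlevel ut i)).
Qed.

Lemma measurable_gcws i t :
  measurable [set w | gcws p u (r ^~ w) (c ^~ w) (beta ^~ w) = Some (i, t)].
Proof.
pose ut := sign_split u; pose a i w := gcws_a p ut (r ^~ w) (c ^~ w) (beta ^~ w) i.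
pose Q i w := (0 < ut i) && [forall i', (0 < ut i') ==> (a i w <= a i' w)].
rewrite (_ : [set _ | _] = [set w | [pick i | Q i w] = Some i] `&`
                           [set w | gcws_t p ut (r ^~ w) (beta ^~ w) i = t]).
  apply: measurableI => //; apply: measurable_pick => l.
  case: (boolP (0 < ut l)) => ul; last first.
    rewrite (_ : [set _ | _] = set0)//.
    by apply/seteqP; split=> w //=; rewrite /Q (negPf ul).
  rewrite (_ : [set _ | _] = \bigcap_(l' in [set l' | 0 < ut l']) [set w | a l w <= a l' w]).
    apply: fin_bigcap_measurable => // l' _.
    have := measurable_fun_ler (ma ut l) (ma ut l').
    by move=> /(_ measurableT [set true]); rewrite setTI; exact.
  apply/seteqP; split=> w /=; rewrite /Q ul /=.
    by move=> /forallP h l' /= ul'; have := h l'; rewrite ul'.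
  by move=> h; apply/forallP => l'; apply/implyP; exact: h.
have gcwsE w : gcws p u (r ^~ w) (c ^~ w) (beta ^~ w) =
  omap (fun i => (i, gcws_t p ut (r ^~ w) (beta ^~ w) i)) [pick i | Q i w] by [].
apply/seteqP; split=> w /=; rewrite gcwsE.
  by case: pick => //= l [-> <-].
by move=> [-> <-].
Qed.
End Gcws.

(** * Joint law of the hash values and the sketch variables *)

Section FiniteValued.
Context {R : realType} {d : measure_display} {T : measurableType d}.
Variables (P : probability T R) (F : finType) (W : T -> F).
Hypothesis mW : forall x, measurable [set w | W w = x].

Lemma expectation_finite (phi : F -> R) :
  'E_P[fun w => phi (W w)]%E = (\sum_x fine (P [set w | W w = x]) * phi x)%:E.
Proof.
pose I x : T -> R := \1_[set w | W w = x].
have E w : (phi (W w))%:E = (\sum_x (phi x)%:E * (I x w)%:E)%E.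
  rewrite (bigD1 (W w))//= big1 => [|x xw]; rewrite /I indicE.
    by rewrite mem_set// mule1 adde0.
  by rewrite memNset ?mule0// => /esym/eqP; apply/negP.
have iI x : P.-integrable setT (fun w => (I x w)%:E).
  by apply: integrable_indic => //; rewrite ltey_eq fin_num_measure.
rewrite unlock; under eq_integral do rewrite E.
rewrite integral_sum//; last by move=> x; exact: integrableZl.
rewrite -sumEFin; apply: eq_bigr => x _.
rewrite integralZl// integral_indic// setIT muleC EFinM fineK//.
exact: fin_num_measure.
Qed.

Lemma probability_finite (Q : pred F) :
  P [set w | Q (W w)] = (\sum_x fine (P [set w | W w = x]) * (Q x)%:R)%:E.
Proof.
have mQ : measurable [set w | Q (W w)].
  rewrite (_ : [set _ | _] = \bigcup_(x in [set x | Q x]) [set w | W w = x]).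
    by apply: fin_bigcup_measurable.
  apply/seteqP; split=> w /=; first by move=> Qw; exists (W w).
  by move=> [x Qx ->].
rewrite -expectation_finite -(expectation_indic P mQ); congr expectation.
apply/funext => w; rewrite indicE; congr (_ %:R); congr nat_of_bool.
by apply/idP/idP; rewrite inE.
Qed.

Lemma sum_probability_finite : \sum_x fine (P [set w | W w = x]) = 1.
Proof.
have := probability_finite xpredT; rewrite [X in P X](_ : _ = setT).
  rewrite probability_setT => -[->].
  by apply: eq_bigr => x _; rewrite mulr1.
by apply/seteqP; split.
Qed.
End FiniteValued.

(** Used to regroup the primitive variables into blocks; the left inverse [e'] carries the test sets
    back to the original indices. *)
Lemma mutually_independent_comp (R : realType) (d : measure_display)
    (T : measurableType d) (P : probability T R) (I J : eqType) (X : I -> T -> R)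
    (e : J -> I) (e' : I -> J) :
  cancel e e' -> mutually_independent P X -> mutually_independent P (fun j => X (e j)).
Proof.
move=> eK [mX H]; split=> [j|s A us mA]; first exact: mX.
have := H (map e s) (fun i => A (e' i)).
rewrite map_inj_uniq; last exact: can_inj eK.
rewrite big_map => /(_ us (fun=> mA _)).
under eq_bigr do rewrite eK.
move=> <-; congr (P _); apply/seteqP; split=> w /= h.
  by move=> _ /= /mapP[j js ->]; rewrite /= eK; exact: h.
by move=> j js; have := h (e j) (map_f e js); rewrite /= eK.
Qed.

Lemma uniform_fin_law_eq (R : realType) (d : measure_display) (T : measurableType d)
    (P : probability T R) (V : finType) (Y Y' : T -> V) (Q : pred V) :
  uniform_fin_law P Y -> uniform_fin_law P Y' ->
  P [set w | Q (Y w)] = P [set w | Q (Y' w)].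
Proof.
move=> [mY lY] [mY' lY']; rewrite !probability_finite//; congr (_%:E).
by apply: eq_bigr => y _; rewrite lY lY'.
Qed.

Section HashSet.
Context {R : realType} (D b : nat) (p : R).

Definition block_index : eqType := ('I_(2 * D) * 'I_3 + 'I_(2 * D) * int)%type.

Implicit Type f : cylinder_space R block_index.

Definition r_of f (i : 'I_(2 * D)) := f (inl (i, Ordinal (isT : 0 < 3)%N)).
Definition c_of f (i : 'I_(2 * D)) := f (inl (i, Ordinal (isT : 1 < 3)%N)).
Definition beta_of f (i : 'I_(2 * D)) := f (inl (i, Ordinal (isT : 2 < 3)%N)).

(** The hash event as a subset of the space of block values. The coordinate inspected is itself
    chosen by the block, so measurability goes through the countably many possible outputs [it]. *)
Definition hash_set (u : 'I_D -> R) (x : 'I_(2 ^ b)) : set (cylinder_space R block_index) :=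
  [set f | exists2 it, gcws p u (r_of f) (c_of f) (beta_of f) = Some it &
                       f (inr it) = (val x)%:R].

Lemma measurable_hash_set u x : measurable (hash_set u x).
Proof.
rewrite (_ : hash_set u x = \bigcup_(it : 'I_(2 * D) * int)
  ([set f | gcws p u (r_of f) (c_of f) (beta_of f) = Some it] `&`
   (fun f : cylinder_space R block_index => f (inr it)) @^-1` [set (val x)%:R])).
  apply: countable_bigcupT_measurable; first exact: countableP.
  move=> [i t]; apply: measurableI.
    apply: (measurable_gcws D p u (fun i f => r_of f i) (fun i f => c_of f i)
      (fun i f => beta_of f i)) => l; exact: measurable_coordinate.
  by rewrite -[_ @^-1` _]setTI; exact: (measurable_coordinate R block_index (inr (i, t))).
by apply/seteqP; split=> f /=; [move=> [it ? ?]; exists it|move=> [it _ [? ?]]; exists it].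
Qed.
End HashSet.
Arguments hash_set {R D b} p u x.

Section JointLaw.
Context {R : realType} {d : measure_display} {T : measurableType d}.
Variables (P : probability T R) (D : nat) (p : R) (b k B : nat) (u v : 'I_D -> R).
Variables (r c beta : 'I_k -> 'I_(2 * D) -> T -> R).
Variable g : 'I_k -> 'I_(2 * D) -> int -> T -> 'I_(2 ^ b).
Variables (h : 'I_(2 ^ b * k) -> T -> 'I_B) (s : 'I_(2 ^ b * k) -> T -> bool).
Hypotheses (lr : forall j i, gamma21_law P (r j i)) (lc : forall j i, gamma21_law P (c j i))
  (lbeta : forall j i, uniform01_law P (beta j i))
  (lg : forall j i t, uniform_fin_law P (g j i t))
  (lh : forall m, uniform_fin_law P (h m)) (ls : forall m, uniform_fin_law P (s m)).
Hypothesis ind : mutually_independent P (prim_family r c beta g h s).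

Let n := (2 ^ b * k)%N.
Let L := block_index D.
Let M : eqType := ('I_n * bool)%type.

Let regroup (x : ('I_k * L + M)%type) : prim_index D b k :=
  match x with
  | inl (j, inl (i, l)) => inl ((j, i), l)
  | inl (j, inr (i, t)) => inr (inl (j, i, t))
  | inr m => inr (inr m)
  end.

Let ungroup (x : prim_index D b k) : ('I_k * L + M)%type :=
  match x with
  | inl (ji, l) => inl (ji.1, inl (ji.2, l))
  | inr (inl jit) => inl (jit.1.1, inr (jit.1.2, jit.2))
  | inr (inr m) => inr m
  end.

Let X (x : ('I_k * L + M)%type) : T -> R := prim_family r c beta g h s (regroup x).

Let indX : mutually_independent P X.
Proof.
apply: (mutually_independent_comp _ _ _ _ _ _ _ regroup ungroup) => //.
by case=> [[j [[i l]|[i t]]]|m].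
Qed.

Let same_law j j' l A : measurable A ->
  P (X (inl (j, l)) @^-1` A) = P (X (inl (j', l)) @^-1` A).
Proof.
move=> mA; case: l => [[i l]|[i t]]; rewrite /X /=.
  case: ifP => _; first by rewrite !lr.
  by case: ifP => _; rewrite ?lc ?lbeta.
have E j1 : (fun w => (val (g j1 i t w))%:R) @^-1` A =
            [set w | (val (g j1 i t w))%:R \in A].
  by apply/seteqP; split=> w /=; rewrite inE.
by rewrite !E; apply: (uniform_fin_law_eq _ _ _ _ _ _ _ (fun y => (val y)%:R \in A)).
Qed.

Let hu j w := hashed_gcws p u r c beta g j w.
Let hv j w := hashed_gcws p v r c beta g j w.

Definition hash_pair_event (j : 'I_k) (xy : 'I_(2 ^ b) * 'I_(2 ^ b)) : set T :=
  [set w | hu j w = Some xy.1 /\ hv j w = Some xy.2].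

Let hash_setP (u' : 'I_D -> R) j w x :
  hash_set p u' x (block X j w) <-> hashed_gcws p u' r c beta g j w = Some x.
Proof.
rewrite /hashed_gcws; split=> /=.
  move=> [[i t] E]; have -> : gcws p u' (r j ^~ w) (c j ^~ w) (beta j ^~ w) = Some (i, t) by [].
  rewrite /block /X /= => /eqP; rewrite eqr_nat => /eqP e.
  by congr Some; exact: val_inj.
case E: gcws => [[i t]|//] [<-].
by exists (i, t).
Qed.

Let hash_pair_eventE j xy : hash_pair_event j xy =
  block X j @^-1` (hash_set p u xy.1 `&` hash_set p v xy.2).
Proof. by apply/seteqP; split=> w /= [/hash_setP ? /hash_setP ?]. Qed.

Let mhash2 (xy : 'I_(2 ^ b) * 'I_(2 ^ b)) :
  measurable (hash_set p u xy.1 `&` hash_set p v xy.2).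
Proof. by apply: measurableI; exact: measurable_hash_set. Qed.

Lemma measurable_hash_pair_event j xy : measurable (hash_pair_event j xy).
Proof.
rewrite hash_pair_eventE -[_ @^-1` _]setTI; apply: (measurable_block P) => //.
Qed.

Lemma hash_pair_event_law j j' xy : P (hash_pair_event j xy) = P (hash_pair_event j' xy).
Proof.
rewrite !hash_pair_eventE; apply: (block_identically_distributed _ _ _ P) => //.
by move=> l A; exact: same_law.
Qed.

Lemma joint_law (th : {ffun 'I_k -> 'I_(2 ^ b) * 'I_(2 ^ b)})
    (hh : {ffun 'I_n -> 'I_B}) (ss : {ffun 'I_n -> bool}) :
  P [set w | (forall j, hash_pair_event j (th j) w) /\
             (forall m, h m w = hh m /\ s m w = ss m)] =
  (\prod_j fine (P (hash_pair_event j (th j))) *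
   (\prod_(m < n) B%:R^-1 * \prod_(m < n) 2^-1))%:E.
Proof.
pose Dm (m : M) : set R := if m.2 then [set (ss m.1)%:R] else [set (val (hh m.1))%:R].
pose C j : set (cylinder_space R L) := hash_set p u (th j).1 `&` hash_set p v (th j).2.
(* [prim_family] encodes signs and bins as reals; the encodings are injective, so singletons of
   reals recover the discrete events. *)
have natB (b1 b2 : bool) : b1%:R = b2%:R :> R -> b1 = b2.
  by move=> /eqP; rewrite eqr_nat; case: b1; case: b2.
have natO N (i1 i2 : 'I_N) : (val i1)%:R = (val i2)%:R :> R -> i1 = i2.
  by move=> /eqP; rewrite eqr_nat => /eqP; exact: val_inj.
have := block_independence P k L M X indX (enum {: 'I_n * bool}) Dm (enum_uniq _) _ C _.
rewrite [X in P X = _](_ : _ = [set w | (forall j, hash_pair_event j (th j) w) /\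
             (forall m, h m w = hh m /\ s m w = ss m)]).
  move=> ->.
  - congr (_%:E); congr (_ * _); first by apply: eq_bigr => j _; rewrite hash_pair_eventE.
    rewrite big_enum /= (eq_bigr (fun q => fine (P (X (inr (q.1, q.2)) @^-1` Dm (q.1, q.2))))).
      2: by case.
    rewrite -(pair_bigA _ (fun m e => fine (P (X (inr (m, e)) @^-1` Dm (m, e))))) /=.
    rewrite -big_split /=; apply: eq_bigr => m _; rewrite big_bool /= mulrC.
    congr (_ * _).
      have [_ /(_ (hh m))] := lh m; rewrite card_ord => E.
      rewrite -[RHS]/(fine (B%:R^-1)%:E) -E; congr (fine (P _)).
      by apply/seteqP; split=> w /=; [exact: natO|rewrite /Dm /X /= => ->].
    have [_ /(_ (ss m))] := ls m; rewrite card_bool => E.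
    rewrite -[RHS]/(fine (2^-1)%:E) -E; congr (fine (P _)).
    by apply/seteqP; split=> w /=; [exact: natB|rewrite /Dm /X /= => ->].
  - by move=> [m []]; exact: measurable_set1.
  - by move=> j; exact: mhash2.
apply/seteqP; split=> w /= [hC hm]; split.
- by move=> j; rewrite hash_pair_eventE; exact: hC.
- move=> m; split.
    by have := hm (m, false); rewrite mem_enum => /(_ isT) /natO.
  by have := hm (m, true); rewrite mem_enum => /(_ isT) /natB.
- by move=> j; have := hC j; rewrite hash_pair_eventE.
- move=> [m e] _; have [hmE smE] := hm m.
  by rewrite /Dm /X /=; case: e => /=; rewrite ?hmE ?smE.
Qed.

End JointLaw.

(** * Moments *)

Section HashedSketch.
Context {R : realType} (b k B : nat).
Hypothesis B0 : (0 < B)%N.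
Let n := (2 ^ b * k)%N.
Let V := ('I_(2 ^ b) * 'I_(2 ^ b))%type.
Implicit Types (th : {ffun 'I_k -> V}) (hh : {ffun 'I_n -> 'I_B}) (ss : {ffun 'I_n -> bool}).

Definition hash_dotB th hh ss : R :=
  dotB (count_sketch hh ss (onehot_cat (fun j => Some (th j).1)))
       (count_sketch hh ss (onehot_cat (fun j => Some (th j).2))).

Definition hash_matches th : nat := (\sum_j ((th j).1 == (th j).2))%N.

Lemma sketch_mean_hash_dotB th :
  sketch_mean n B (hash_dotB th) = (hash_matches th)%:R.
Proof.
rewrite /hash_dotB (sketch_mean_dotB n B B0).
exact: (sum_onehot_cat_mul b k (fun j => (th j).1) (fun j => (th j).2)).
Qed.

(** Bias-variance split about the conditional mean. The squared norms of the one-hot vectors equal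
    [k], and their entries are idempotent, so all three sums reduce to [k] and the number of
    matches. *)
Lemma sketch_mean_hash_dotB_sqr th (x : R) :
  sketch_mean n B (fun hh ss => (hash_dotB th hh ss - x) ^+ 2) =
  B%:R^-1 * (k%:R ^+ 2 + (hash_matches th)%:R ^+ 2 - 2 * (hash_matches th)%:R)
  + ((hash_matches th)%:R - x) ^+ 2.
Proof.
pose a : R := (hash_matches th)%:R.
have E hh ss : (hash_dotB th hh ss - x) ^+ 2 =
  (hash_dotB th hh ss - a) ^+ 2 + (2 * (a - x) * hash_dotB th hh ss + (x ^+ 2 - a ^+ 2)).
  by ring.
transitivity (sketch_mean n B (fun hh ss => (hash_dotB th hh ss - a) ^+ 2) +
    (2 * (a - x) * sketch_mean n B (hash_dotB th) + (x ^+ 2 - a ^+ 2))).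
  rewrite /sketch_mean -ffun_meanZ.
  rewrite -[x ^+ 2 - a ^+ 2](ffun_mean_cst (I := 'I_n) _ (sum_inv_card R B B0)).
  rewrite -!ffun_meanD; apply: eq_ffun_mean => hh; rewrite -ffun_meanZ.
  rewrite -[x ^+ 2 - a ^+ 2](ffun_mean_cst (I := 'I_n) _ sum_half).
  by rewrite -!ffun_meanD; apply: eq_ffun_mean => ss.
rewrite sketch_mean_hash_dotB -/a.
have aE : a = \sum_i (onehot_cat (fun j => Some (th j).1) i : R) *
                     onehot_cat (fun j => Some (th j).2) i.
  exact/esym/(sum_onehot_cat_mul b k (fun j => (th j).1) (fun j => (th j).2)).
rewrite {1}aE /hash_dotB (sketch_mean_dotB_centered_sqr n B B0) -aE.
rewrite (sum_onehot_cat_sqr b k (fun j => (th j).1)).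
rewrite (sum_onehot_cat_sqr b k (fun j => (th j).2)).
under [X in 2 * X]eq_bigr do rewrite exprMn (onehot_cat_sqr b k (fun j => (th j).1))
   (onehot_cat_sqr b k (fun j => (th j).2)).
by rewrite -aE; ring.
Qed.

Lemma hash_mean_dotB (q : V -> R) : \sum_x q x = 1 ->
  ffun_mean q (fun t => sketch_mean n B (hash_dotB t)) =
  k%:R * \sum_x q x * (x.1 == x.2)%:R.
Proof.
move=> q1; under eq_ffun_mean do rewrite sketch_mean_hash_dotB.
by rewrite (ffun_mean_matches q (fun x => x.1 == x.2) q1) card_ord.
Qed.

(** Law of total variance, by averaging the conditional second moment with [E a = k * pm] and
    [E a^2 = k * pm + k * (k - 1) * pm^2]. *)
Lemma hash_mean_dotB_sqr (q : V -> R) : \sum_x q x = 1 ->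
  let pm := \sum_x q x * (x.1 == x.2)%:R in
  ffun_mean q (fun t => sketch_mean n B (fun hh ss => (hash_dotB t hh ss - k%:R * pm) ^+ 2)) =
  B%:R^-1 * (k%:R ^+ 2 + k%:R ^+ 2 * pm ^+ 2 - k%:R * pm ^+ 2 - k%:R * pm)
  + k%:R * pm * (1 - pm).
Proof.
move=> q1 pm; under eq_ffun_mean do rewrite sketch_mean_hash_dotB_sqr.
have E t : B%:R^-1 * (k%:R ^+ 2 + (hash_matches t)%:R ^+ 2 - 2 * (hash_matches t)%:R)
    + ((hash_matches t)%:R - k%:R * pm) ^+ 2 =
  (B%:R^-1 + 1) * (hash_matches t)%:R ^+ 2 +
  (- 2 * (B%:R^-1 + k%:R * pm) * (hash_matches t)%:R +
   (B%:R^-1 * k%:R ^+ 2 + (k%:R * pm) ^+ 2)) :> R.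
  by ring.
under eq_ffun_mean do rewrite E.
rewrite !ffun_meanD !ffun_meanZ !ffun_mean_cst//.
rewrite (ffun_mean_matches q (fun x => x.1 == x.2) q1).
rewrite (ffun_mean_matches_sqr q (fun x => x.1 == x.2) q1) card_ord -/pm.
by ring.
Qed.

Context {d : measure_display} {T : measurableType d}.
Variables (P : probability T R) (q : V -> R).
Variables (th : T -> {ffun 'I_k -> V}) (h : T -> {ffun 'I_n -> 'I_B})
  (s : T -> {ffun 'I_n -> bool}).
Let W w := (th w, (h w, s w)).
Hypothesis mW : forall x, measurable [set w | W w = x].
Hypothesis law : forall t hh ss, P [set w | W w = (t, (hh, ss))] =
  (\prod_j q (t j) * (\prod_(m < n) B%:R^-1 * \prod_(m < n) 2^-1))%:E.

Lemma expectation_hashes phi :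
  'E_P[fun w => phi (th w) (h w) (s w)]%E =
  (ffun_mean q (fun t => sketch_mean n B (phi t)))%:E.
Proof.
rewrite (expectation_finite P _ W mW (fun x => phi x.1 x.2.1 x.2.2)); congr (_%:E).
rewrite (eq_bigr (fun x => fine (P [set w | W w = (x.1, x.2)]) * phi x.1 x.2.1 x.2.2)).
  2: by case.
rewrite -(pair_bigA _ (fun t y => fine (P [set w | W w = (t, y)]) * phi t y.1 y.2)) /=.
apply: eq_bigr => t _.
rewrite (eq_bigr (fun x => fine (P [set w | W w = (t, (x.1, x.2))]) * phi t x.1 x.2)).
  2: by case.
rewrite -(pair_bigA _ (fun hh ss => fine (P [set w | W w = (t, (hh, ss))]) * phi t hh ss)) /=.
rewrite /sketch_mean /ffun_mean /= mulr_sumr; apply: eq_bigr => hh _.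
rewrite !mulr_sumr; apply: eq_bigr => ss _.
by rewrite law /= !mulrA.
Qed.

(** The hash weight of [t] factors out of the numerator; the same computation with the constant 1
    identifies it as the probability of the conditioning event, and it cancels. *)
Lemma cond_exp_hashes phi t : (0 < P [set w | th w = t])%E ->
  cond_exp P (fun w => phi (th w) (h w) (s w)) [set w | th w = t] =
  sketch_mean n B (phi t).
Proof.
move=> Pt0.
have E psi : 'E_P[(fun w => psi (th w) (h w) (s w)) \* \1_[set w | th w = t]]%E =
    (\prod_j q (t j) * sketch_mean n B (psi t))%:E.
  rewrite [X in expectation P X](_ : _ = (fun w => (fun t' hh ss => (t' == t)%:R * psi t' hh ss)
    (th w) (h w) (s w))).
    rewrite (expectation_hashes (fun t' hh ss => (t' == t)%:R * psi t' hh ss)).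
    congr (_%:E).
    rewrite /ffun_mean (bigD1 t)//= eqxx [X in _ + X]big1 ?addr0 => [|t' /negPf t't].
      by congr (_ * _); apply: eq_ffun_mean => hh; apply: eq_ffun_mean => ss; rewrite mul1r.
    rewrite t't /sketch_mean (eq_ffun_mean _ _ (fun=> 0 * 0)) ?ffun_meanZ ?mul0r ?mulr0// => hh.
    by rewrite ffun_meanZ mul0r.
  apply/funext => w /=; rewrite indicE mulrC; congr (_ %:R * _); congr nat_of_bool.
  by apply/idP/eqP; rewrite inE.
have PE : P [set w | th w = t] = (\prod_j q (t j))%:E.
  have := E (fun _ _ _ => 1); rewrite [X in expectation P X](_ : _ = \1_[set w | th w = t]).
    rewrite expectation_indic.
      rewrite /sketch_mean !ffun_mean_cst ?mulr1//; first exact: sum_half.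
      exact: sum_inv_card.
    rewrite (_ : [set _ | _] = \bigcup_(y in setT) [set w | W w = (t, y)]).
      by apply: fin_bigcup_measurable.
    apply/seteqP; split=> w /=; first by move=> <-; exists (h w, s w).
    by move=> [[hh ss] _ [->]].
  by apply/funext => w /=; rewrite mul1r.
rewrite /cond_exp E PE /= mulrC mulKf//.
by move: Pt0; rewrite PE lte_fin => /lt0r_neq0.
Qed.

End HashedSketch.

Lemma variance_def (R : realType) (d : measure_display) (T : measurableType d)
    (P : probability T R) (X : T -> R) (x : R) :
  'E_P[X]%E = x%:E -> 'V_P[X]%E = 'E_P[fun w => ((X w - x) ^+ 2)%R]%E.
Proof.
by move=> EX; rewrite /variance covariance.unlock EX /=; congr expectation.
Qed.

Theorem theorem4 (R : realType) (d : measure_display) (T : measurableType d)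
  (P : probability T R) (D : nat) (p : R) (b k B : nat) (u v : 'I_D -> R)
  (r c beta : 'I_k -> 'I_(2 * D) -> T -> R)
  (g : 'I_k -> 'I_(2 * D) -> int -> T -> 'I_(2 ^ b))
  (h : 'I_(2 ^ b * k) -> T -> 'I_B) (s : 'I_(2 ^ b * k) -> T -> bool)
  (Pb : R) :
  (1 <= D)%N -> 0 < p -> (1 <= b)%N -> (1 <= k)%N -> (1 <= B)%N ->
  (exists i, u i != 0) -> (exists i, v i != 0) ->
  (forall j i, gamma21_law P (r j i)) ->
  (forall j i, gamma21_law P (c j i)) ->
  (forall j i, uniform01_law P (beta j i)) ->
  (forall j i t, uniform_fin_law P (g j i t)) ->
  (forall m, uniform_fin_law P (h m)) ->
  (forall m, uniform_fin_law P (s m)) ->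
  mutually_independent P (prim_family r c beta g h s) ->
  (forall j0 : 'I_k, val j0 = 0%N ->
     P [set w | hashed_gcws p u r c beta g j0 w = hashed_gcws p v r c beta g j0 w]
     = Pb%:E) ->
  let Z := sketch_inner p u v r c beta g h s in
  let a := n_matches p u v r c beta g in
  (* conditional on GCWS (the hashed values) *)
  (forall thu thv : 'I_k -> option 'I_(2 ^ b),
     let A := [set w | forall j, hashed_gcws p u r c beta g j w = thu j /\
                                 hashed_gcws p v r c beta g j w = thv j] in
     let aA := (\sum_(j < k) (thu j == thv j))%N in
     (0 < P A)%E ->
     cond_exp P Z A = aA%:R /\
     cond_var P Z A = B%:R^-1 * (k%:R ^+ 2 + aA%:R ^+ 2 - 2 * aA%:R)) /\
  (* a ~ Bin(k, Pb) *)
  (forall n : nat,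
     P [set w | a w = n] = ('C(k, n)%:R * Pb ^+ n * (1 - Pb) ^+ (k - n))%:E) /\
  (* unconditional moments *)
  ('E_P[Z] = (k%:R * Pb)%:E)%E /\
  ('V_P[Z] = (B%:R^-1 * (k%:R ^+ 2 + k%:R ^+ 2 * Pb ^+ 2 - k%:R * Pb ^+ 2 - k%:R * Pb)
             + k%:R * Pb * (1 - Pb))%:E)%E /\
  (* the estimator Pb_hat = <z,w>/k *)
  ('E_P[fun w => (Z w / k%:R)%R] = Pb%:E)%E /\
  ('V_P[fun w => (Z w / k%:R)%R] =
    (Pb * (1 - Pb) / k%:R
     + B%:R^-1 * (1 + Pb ^+ 2 - Pb ^+ 2 / k%:R - Pb / k%:R))%:E)%E.
Proof.
move=> D1 p0 b1 k1 B1 u0 v0 lr lc lbeta lg lh ls ind hPb Z a.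
pose j0 : 'I_k := Ordinal k1.
have b0 : (0 < 2 ^ b)%N by rewrite expn_gt0.
(* Only a filler making [th] total: [huE] and [hvE] show that every hash value is a [Some]. *)
pose x0 : 'I_(2 ^ b) := Ordinal b0.
pose th w : {ffun 'I_k -> 'I_(2 ^ b) * 'I_(2 ^ b)} :=
  [ffun j => (odflt x0 (hashed_gcws p u r c beta g j w),
              odflt x0 (hashed_gcws p v r c beta g j w))].
pose hf w : {ffun 'I_(2 ^ b * k) -> 'I_B} := [ffun m => h m w].
pose sf w : {ffun 'I_(2 ^ b * k) -> bool} := [ffun m => s m w].
have huE j w : hashed_gcws p u r c beta g j w = Some (th w j).1.
  rewrite ffunE /= /hashed_gcws.
  by have := gcws_isSome D p u (r j ^~ w) (c j ^~ w) (beta j ^~ w) u0; case: gcws.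
have hvE j w : hashed_gcws p v r c beta g j w = Some (th w j).2.
  rewrite ffunE /= /hashed_gcws.
  by have := gcws_isSome D p v (r j ^~ w) (c j ^~ w) (beta j ^~ w) v0; case: gcws.
pose ev j xy := hash_pair_event D p b k u v r c beta g j xy.
have evE j xy : ev j xy = [set w | th w j = xy].
  apply/seteqP; split=> w; rewrite /ev /hash_pair_event /= huE hvE.
    by case: (th w j) => x y /= [[->] [->]]; case: xy.
  by move=> ->.
have mev j xy : measurable [set w | th w j = xy].
  by rewrite -evE; exact: measurable_hash_pair_event ind _ _.
(* The common law of a pair of hash values, read off in block 0, the block in which [Pb] is
   given. *)
pose q xy := fine (P [set w | th w j0 = xy]).
have qE j xy : fine (P [set w | th w j = xy]) = q xy.
  by rewrite /q -!evE (hash_pair_event_law _ _ _ _ _ _ _ _ _ _ _ _ _ _ lr lc lbeta lg ind j j0).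
have WE t hh ss : [set w | (th w, (hf w, sf w)) = (t, (hh, ss))] =
    [set w | (forall j, ev j (t j) w) /\ (forall m, h m w = hh m /\ s m w = ss m)].
  apply/seteqP; split=> w /=.
    move=> [<- <- <-]; split=> [j|m]; first by rewrite evE.
    by rewrite !ffunE.
  move=> [ht hs]; congr (_, (_, _)); apply/ffunP => i.
  - by have := ht i; rewrite evE.
  - by rewrite ffunE; case: (hs i).
  - by rewrite ffunE; case: (hs i).
have mW x : measurable [set w | (th w, (hf w, sf w)) = x].
  case: x => t [hh ss]; rewrite WE.
  rewrite (_ : [set _ | _] = (\bigcap_(j in setT) ev j (t j)) `&`
     (\bigcap_(m in setT) ([set w | h m w = hh m] `&` [set w | s m w = ss m]))).
    apply: measurableI; apply: fin_bigcap_measurable => // i _; first by rewrite evE.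
    by apply: measurableI; [case: (lh i)|case: (ls i)].
  apply/seteqP; split=> w /=.
    by move=> [ht hs]; split=> i _; [exact: ht|exact: hs].
  by move=> [ht hs]; split=> i; [exact: ht|exact: hs].
have law t hh ss : P [set w | (th w, (hf w, sf w)) = (t, (hh, ss))] =
    (\prod_j q (t j) * (\prod_(m < 2 ^ b * k) B%:R^-1 * \prod_(m < 2 ^ b * k) 2^-1))%:E.
  rewrite WE (joint_law P D p b k B u v r c beta g h s lh ls ind); congr (_%:E).
  by congr (_ * _); apply: eq_bigr => j _; rewrite -/(ev _ _) evE qE.
have q1 : \sum_x q x = 1.
  exact: (sum_probability_finite P _ (fun w => th w j0) (mev j0)).
have PbE : Pb = \sum_x q x * (x.1 == x.2)%:R.
  have /(_ j0 erefl) := hPb.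
  rewrite [X in P X](_ : _ = [set w | (th w j0).1 == (th w j0).2]).
    rewrite (probability_finite P _ (fun w => th w j0) (mev j0) (fun x => x.1 == x.2)).
    by move=> [<-].
  by apply/seteqP; split=> w /=; rewrite huE hvE; [move=> [->]|move=> /eqP ->].
have ZE : Z = fun w => hash_dotB b k B (th w) (hf w) (sf w).
  apply/funext => w; rewrite /Z /sketch_inner /hash_dotB.
  rewrite (_ : (fun j => hashed_gcws p u r c beta g j w) = (fun j => Some (th w j).1)).
    2: by apply/funext.
  rewrite (_ : (fun j => hashed_gcws p v r c beta g j w) = (fun j => Some (th w j).2)).
    2: by apply/funext.
  rewrite (_ : h ^~ w = hf w); last by apply/funext => m; rewrite ffunE.
  by rewrite (_ : s ^~ w = sf w)//; apply/funext => m; rewrite ffunE.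
have EE := expectation_hashes b k B P q th hf sf mW law.
have EZ : 'E_P[Z]%E = (k%:R * Pb)%:E.
  by rewrite ZE (EE (hash_dotB b k B)) hash_mean_dotB// PbE.
have VZ : 'E_P[fun w => ((Z w - k%:R * Pb) ^+ 2)%R]%E =
    (B%:R^-1 * (k%:R ^+ 2 + k%:R ^+ 2 * Pb ^+ 2 - k%:R * Pb ^+ 2 - k%:R * Pb)
             + k%:R * Pb * (1 - Pb))%:E.
  rewrite ZE (EE (fun t hh ss => (hash_dotB b k B t hh ss - k%:R * Pb) ^+ 2)).
  by rewrite PbE hash_mean_dotB_sqr.
have k0 : k%:R != 0 :> R by rewrite pnatr_eq0 -lt0n.
have EZk : 'E_P[fun w => (Z w / k%:R)%R]%E = Pb%:E.
  rewrite ZE (EE (fun t hh ss => hash_dotB b k B t hh ss / k%:R)).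
  have := EZ; rewrite ZE (EE (hash_dotB b k B)) => -[E].
  congr (_%:E); apply: (mulfI k0); rewrite -E -ffun_meanZ.
  apply: eq_ffun_mean => t; rewrite /sketch_mean -ffun_meanZ.
  apply: eq_ffun_mean => hh; rewrite -ffun_meanZ.
  by apply: eq_ffun_mean => ss; rewrite mulrC divfK.
split; [|split; [|split; [|split; [|split]]]] => //.
- move=> thu thv A aA PA0.
  (* A conditioning event of positive probability contains an outcome, whose hash values must be
     [thu] and [thv]; hence these are all [Some] and [A] is a fibre of [th]. *)
  have [w Aw] : A !=set0.
    apply/set0P/eqP => A0; move: PA0; rewrite A0 measure0; by rewrite ltxx.
  pose t := th w.
  have thuE j : thu j = Some (t j).1 by rewrite -huE; case: (Aw j).
  have thvE j : thv j = Some (t j).2 by rewrite -hvE; case: (Aw j).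
  have AE : A = [set w | th w = t].
    apply/seteqP; split=> w' /=.
      move=> Aw'; apply/ffunP => j; have [] := Aw' j.
      rewrite huE hvE thuE thvE.
      by case: (th w' j) (t j) => x y [x' y'] /= [->] [->].
    by move=> E j; rewrite huE hvE E thuE thvE.
  have aAE : aA = hash_matches b k t.
    by apply: eq_bigr => j _; rewrite thuE thvE.
  rewrite aAE AE in PA0 *.
  have CE := fun phi => cond_exp_hashes b k B B1 P q th hf sf mW law phi t PA0.
  have E1 : cond_exp P Z [set w | th w = t] = (hash_matches b k t)%:R.
    by rewrite ZE (CE (hash_dotB b k B)) sketch_mean_hash_dotB.
  split=> //; rewrite /cond_var E1 ZE.
  rewrite (CE (fun t' hh ss => (hash_dotB b k B t' hh ss - (hash_matches b k t)%:R) ^+ 2)).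
  by rewrite sketch_mean_hash_dotB_sqr// subrr expr0n addr0.
- move=> n.
  have -> : [set w | a w = n] = [set w | (fun x => hash_matches b k x.1 == n) (th w, (hf w, sf w))].
    have aE w : a w = hash_matches b k (th w).
      by apply: eq_bigr => j _; rewrite huE hvE.
    by apply/seteqP; split=> w /=; rewrite aE => /eqP.
  rewrite (probability_finite P _ _ mW (fun x => hash_matches b k x.1 == n)).
  (* Back to the expectation of an indicator, so that [EE] turns it into a mean under product
     weights. *)
  rewrite -(expectation_finite P _ _ mW (fun x => (hash_matches b k x.1 == n)%:R)) /=.
  rewrite (EE (fun t _ _ => (hash_matches b k t == n)%:R)); congr (_%:E).
  rewrite PbE -[X in 'C(X, _)]card_ord -[X in _ ^+ (X - _)]card_ord.
  rewrite -(ffun_mean_count q (fun x => x.1 == x.2) q1 n); apply: eq_ffun_mean => t.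
  by rewrite /sketch_mean !ffun_mean_cst//; [exact: sum_half|exact: sum_inv_card].
- by rewrite (variance_def _ _ _ _ _ _ EZ).
- rewrite (variance_def _ _ _ _ _ _ EZk) ZE.
  rewrite (EE (fun t hh ss => (hash_dotB b k B t hh ss / k%:R - Pb) ^+ 2)).
  have := VZ; rewrite ZE (EE (fun t hh ss => (hash_dotB b k B t hh ss - k%:R * Pb) ^+ 2)) => -[E].
  (* After multiplication by [k^2] the centred square of the estimator becomes that of [Z], whose
     mean is known from [VZ]. *)
  congr (_%:E); apply: (@mulfI _ (k%:R ^+ 2)); first by rewrite expf_neq0.
  transitivity (B%:R^-1 * (k%:R ^+ 2 + k%:R ^+ 2 * Pb ^+ 2 - k%:R * Pb ^+ 2 - k%:R * Pb)
             + k%:R * Pb * (1 - Pb)).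
    rewrite -E -ffun_meanZ.
    apply: eq_ffun_mean => t; rewrite /sketch_mean -ffun_meanZ.
    apply: eq_ffun_mean => hh; rewrite -ffun_meanZ.
    by apply: eq_ffun_mean => ss; rewrite -exprMn mulrBr mulrCA divff ?mulr1.
  have B0 : B%:R != 0 :> R by rewrite pnatr_eq0 -lt0n.
  by field; rewrite k0.
Qed.
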